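(* For every integer $d\ge 2$, the critical probability $p_{\mathrm L}=p_{\mathrm L}(d)$ for Lipschitz percolation in $\mathbb Z^d$ satisfies $$p_{\mathrm L}\le 1-\frac{1}{8(d-1)}.$$
   Context: Let $\mathbb Z^+=\{1,2,\dots\}$ and let $\|\cdot\|$ be the $\ell^1$-norm. Site percolation on $\mathbb Z^d$ with parameter $p\in[0,1]$: each site is independently open with probability $p$ and closed otherwise; the law is $\mathbb P_p$. A function $F:\mathbb Z^{d-1}\to\mathbb Z^+$ is Lipschitz if $|F(x)-F(y)|\le 1$ for all $x,y\in\mathbb Z^{d-1}$ with $\|x-y\|=1$. Let $\mathrm{LIP}$ be the event that there exists a Lipschitz function $F:\mathbb Z^{d-1}\to\mathbb Z^+$ such that, for each $x\in\mathbb Z^{d-1}$, the site $(x,F(x))\in\mathbb Z^d$ is open. The event $\mathrm{LIP}$ is increasing and has $\mathbb P_p$-probability $0$ or $1$; $p_{\mathrm L}=p_{\mathrm L}(d)\in[0,1]$ is the number such that $\mathbb P_p(\mathrm{LIP})=0$ if $p<p_{\mathrm L}$ and $\mathbb P_p(\mathrm{LIP})=1$ if $p>p_{\mathrm L}$. *)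

(* Defs.v *)
From HB Require Import structures.
From mathcomp Require Import all_boot all_order all_algebra finmap.
From mathcomp Require Import all_classical all_reals all_analysis.
Set Implicit Arguments.
Unset Strict Implicit.
Unset Printing Implicit Defensive.
Import Order.TTheory GRing.Theory Num.Theory.
Local Open Scope classical_set_scope.
Local Open Scope ring_scope.

Definition site (d : nat) := 'rV[int]_d.

(* [true] means open. *)
Definition config_fun (d : nat) := site d -> bool.

Definition site_open_events (d : nat) : set (set (config_fun d)) :=
  [set A | exists s : site d, A = [set w : config_fun d | w s]].

(* Configurations carry the product sigma-algebra. *)
Definition config (d : nat) := g_sigma_algebraType (@site_open_events d).

(* The law of site percolation with parameter p, given by its values on the
   finite-dimensional cylinders (a pi-system generating the sigma-algebra). *)
Definition is_site_percolation (R : realType) (d : nat) (p : R)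
    (P : probability (config d) R) : Prop :=
  forall (S : {fset site d}) (eta : site d -> bool),
    P [set w : config d | forall s, s \in S -> w s = eta s]
    = (\prod_(s <- S) (if eta s then p else 1 - p))%:E.

Definition l1norm (n : nat) (x : 'rV[int]_n) : int := \sum_(i < n) `|x 0 i|.

Definition lipschitz_fun (n : nat) (F : 'rV[int]_n -> int) : Prop :=
  forall x y : 'rV[int]_n, l1norm (x - y) = 1 -> `|F x - F y| <= 1.

(* The site (x, h): coordinate i < d.-1 is that of x, the last one is h. *)
Definition site_over (d : nat) (x : 'rV[int]_d.-1) (h : int) : site d :=
  \row_(i < d) oapp (x 0) h (insub (val i)).

Definition LIP (d : nat) : set (config d) :=
  [set w : config d | exists F : 'rV[int]_d.-1 -> int,
     [/\ forall x, 0 < F x,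
         lipschitz_fun F
       & forall x, w (site_over x (F x))] ].

Definition is_critical_probability (R : realType) (d : nat)
    (P : R -> probability (config d) R) (pL : R) : Prop :=
  [/\ 0 <= pL <= 1,
      forall p, 0 <= p <= 1 -> p < pL -> P p (@LIP d) = 0%:E
    & forall p, 0 <= p <= 1 -> pL < p -> P p (@LIP d) = 1%:E].

(* Main.v *)
Require Import Defs.
From mathcomp Require Import all_boot all_order all_algebra finmap.
From mathcomp Require Import all_classical all_reals all_analysis.
From mathcomp Require Import zify lra ring.
Import Order.TTheory GRing.Theory Num.Theory.
Import numFieldNormedType.Exports.
Local Open Scope ring_scope.

(** Fix a configuration [w] and walk in the lattice as follows.  From a site
    one may step one level down provided that the current site is closed, and
    one may always step one level up while moving to a neighbouring column.
    Say that a site is reached if some such walk leads from it to height 0.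
    (Read backwards, these are the admissible paths that climb through closed
    sites and descend diagonally.)

    Reached sites are exactly the obstruction to an open Lipschitz surface
    ([LIP_reach]).  An open Lipschitz surface lies strictly above every reached
    site.  Conversely, if every column contains a site of positive height that
    is not reached, then the lowest such heights form an open Lipschitz
    surface: a jump of more than 1 between neighbouring columns would let the
    lower site be reached by a diagonal step, and a closed site on the surface
    would be reached by a downward step.

    It remains to see that high sites are unlikely to be reached, which is a
    first moment estimate ([prob_reach_le]).  Let [n] be the dimension of the
    base and [q] the probability that a site is closed.  A walk may be
    shortened so that its downward steps leave pairwise distinct sites
    ([walk_simplify]); a walk with [U] downward steps is then available with
    probability [q ^ U].  A walk from height [h] to height 0 with [D] diagonal
    steps has [U = h + D], so for every [theta > 0]
      [q ^ U = theta ^ h * (q / theta) ^ U * theta ^ D],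
    and the sum over all walks of length [N] is at most
    [theta ^ h * (q / theta + 2 n theta) ^ N], since there are [2 n] diagonal
    steps and one downward step.  With [theta = 1 / (4 n)] the base of this
    power is [4 n q + 1 / 2], which is less than 1 exactly when [q < 1 / (8 n)].
    Summing over [N], the probability of reaching height [h] is
    [O (theta ^ h)], so almost surely no column is reached at all positive
    heights, and [LIP] has probability 1 ([prob_LIP1]).  Hence no [p] above
    [1 - 1 / (8 n)] lies below the critical probability. *)

Set Implicit Arguments.
Unset Strict Implicit.
Unset Printing Implicit Defensive.

(** * Walks *)

Section Walks.
Context {n : nat}.

(** [None] is the step down and [Some (i, b)] the diagonal step up in direction
    [+e_i] or [-e_i]. *)
Local Notation letter := (option ('I_n * bool)%type).
Local Notation pos := ('rV[int]_n * int)%type.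

Definition unit_vec (ib : 'I_n * bool) : 'rV[int]_n :=
  if ib.2 then delta_mx 0 ib.1 else - delta_mx 0 ib.1.

Definition move (z : pos) (a : letter) : pos :=
  if a is Some ib then (z.1 + unit_vec ib, z.2 + 1) else (z.1, z.2 - 1).

(** The sites from which the walk steps down, which are those required to be
    closed. *)
Fixpoint drops (z : pos) (s : seq letter) : seq pos :=
  if s is a :: s' then
    if a is Some _ then drops (move z a) s' else z :: drops (move z a) s'
  else [::].

Definition walk_end (z : pos) (s : seq letter) : pos := foldl move z s.

(** A site that is left downwards splits the walk, and the part after the split
    is itself a walk starting there. *)
Lemma drops_suffix (z z' : pos) (s : seq letter) : z' \in drops z s ->
  exists2 t, walk_end z' t = walk_end z s & subseq (drops z' t) (drops z s).
Proof.
elim: s z => [|a s IHs] z //=.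
case: a => [ib|] /=; first exact: IHs.
rewrite inE => /orP[/eqP->|/IHs[t et st]].
  by exists (None :: s) => //=; rewrite eqxx.
exists t => //; exact: (subseq_trans st (subseq_cons _ _)).
Qed.

(** Loop erasure: if the walk steps down from [z] and later does so again, the
    part in between can be cut out.  Only the sites of the downward steps need
    to be made distinct, because the other sites are not asked to be closed. *)
Lemma walk_simplify (z : pos) (s : seq letter) :
  exists t, [/\ walk_end z t = walk_end z s,
    {subset drops z t <= drops z s} & uniq (drops z t)].
Proof.
elim: s z => [|a s IHs] z; first by exists [::].
have [t [et st ut]] := IHs (move z a).
case: a et st ut => [ib|] et st ut; first by exists (Some ib :: t).
have [zt|zt] := boolP (z \in drops (move z None) t).
  have [t' et' st'] := drops_suffix zt; exists t'; split.
  - by rewrite et' et.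
  - move=> y /(mem_subseq st') /st yt; by rewrite /= inE yt orbT.
  - exact: subseq_uniq st' ut.
exists (None :: t); split => //=; last by rewrite zt.
move=> y; rewrite !inE => /orP[->//|/st ->]; exact: orbT.
Qed.

(** * Reached sites and open Lipschitz surfaces *)

Lemma l1norm_unit_vec (ib : 'I_n * bool) : l1norm (unit_vec ib) = 1.
Proof.
rewrite /l1norm (bigD1 ib.1) //= big1 ?addr0.
  by rewrite /unit_vec; case: ib.2; rewrite !mxE !eqxx.
move=> j /negbTE nj; rewrite /unit_vec.
by case: ib.2; rewrite !mxE nj andbF.
Qed.

Lemma l1norm_eq1 (x : 'rV[int]_n) : l1norm x = 1 ->
  exists ib, x = unit_vec ib.
Proof.
move=> x1.
have [i xi] : exists i, x 0 i != 0.
  apply/existsP; apply: contraT => /existsPn x0; move: x1.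
  by rewrite /l1norm big1 // => i _; have := x0 i; rewrite negbK => /eqP ->.
move: x1; rewrite /l1norm (bigD1 i) //= => x1.
have s0 : 0 <= \sum_(j < n | j != i) `|x 0 j| by apply: sumr_ge0.
have [xi1 r0] : `|x 0 i| = 1 /\ \sum_(j < n | j != i) `|x 0 j| = 0.
  move: xi s0 x1; move: (\sum_(j < n | _) _) (x 0 i) => S a; lia.
have xj j : j != i -> x 0 j = 0.
  move=> ji; apply/eqP; rewrite -normr_eq0; apply/eqP.
  by apply: (psumr_eq0P _ r0) => // k _; exact: normr_ge0.
exists (i, 0 < x 0 i); apply/rowP => j; rewrite /unit_vec /=.
have [->|ji] := eqVneq j i; last first.
  by rewrite xj //; case: ifP => _; rewrite !mxE (negbTE ji) andbF.
by case: ifP => xp; rewrite !mxE !eqxx /=; lia.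
Qed.

Lemma site_over_inj : injective (fun z : pos => @site_over n.+1 z.1 z.2).
Proof.
move=> [x h] [y k] /= /rowP e; congr pair.
  apply/rowP => i; have := e (widen_ord (leqnSn n) i).
  rewrite !mxE /=; case: insubP => [j _ /= ej|]; last by rewrite ltn_ord.
  by rewrite (val_inj ej : j = i).
have := e ord_max; rewrite !mxE /=; case: insubP => [j /= |//].
by rewrite ltnn.
Qed.

Definition site_at (z : pos) : site n.+1 := @site_over n.+1 z.1 z.2.

Definition all_closed (w : config_fun n.+1) (s : seq pos) : bool :=
  all (fun z => ~~ w (site_at z)) s.

Definition reach (w : config_fun n.+1) (z : pos) : Prop :=
  exists s, (walk_end z s).2 = 0 /\ all_closed w (drops z s).

Lemma reach_simple (w : config_fun n.+1) (z : pos) : reach w z ->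
  exists s, [/\ (walk_end z s).2 = 0, uniq (drops z s)
    & all_closed w (drops z s)].
Proof.
case=> s [e c]; have [t [et st ut]] := walk_simplify z s.
exists t; rewrite et; split=> //; apply/allP => y /st; exact: (allP c).
Qed.

Lemma reach_base w x : reach w (x, 0).
Proof. by exists [::]. Qed.

Lemma reach_down w (z : pos) : ~~ w (site_at z) -> reach w (z.1, z.2 - 1) ->
  reach w z.
Proof. by move=> cz [s [e c]]; exists (None :: s); rewrite /= cz. Qed.

Lemma reach_diag w (z : pos) ib :
  reach w (z.1 + unit_vec ib, z.2 + 1) -> reach w z.
Proof. by move=> [s [e c]]; exists (Some ib :: s). Qed.

(** A walk that ends at height 0 ends below the surface, and it never crosses
    the surface.  Read backwards, a step that rises by 1 starts below the
    surface and ends at a closed site, hence not on the surface; a diagonal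
    step lowers the walk by 1, and the surface drops by at most 1. *)
Lemma lipschitz_above_reach (w : config_fun n.+1)
    (F : 'rV[int]_n -> int) (z : pos) :
  (forall x, 0 < F x) -> lipschitz_fun F ->
  (forall x, w (@site_over n.+1 x (F x))) ->
  reach w z -> z.2 < F z.1.
Proof.
move=> F0 lF oF [s [e c]]; elim: s z e c => [|a s IHs] z /= e c.
  by rewrite e.
case: a e c => [ib|] e c.
  have /= := IHs _ e c.
  have := lF (z.1 + unit_vec ib) z.1; rewrite addrC addKr.
  move=> /(_ (l1norm_unit_vec ib)); move: (F _) (F _) z.2 => a b k; lia.
case/andP: c => cz c; have /= := IHs _ e c.
have : z.2 != F z.1 by apply: contraNneq cz => ez; rewrite /site_at ez.
lia.
Qed.

(** The surface is the graph of the lowest heights that are not reached.  The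
    equivalence also shows that [LIP] is measurable: the quantifiers on the
    right are countable, whereas those in [LIP] range over all functions [F]. *)
Lemma LIP_reach (w : config n.+1) :
  LIP w <-> forall x, exists h : nat, ~ reach w (x, h.+1%:Z).
Proof.
split.
  move=> [F [F0 lF oF]] x; exists `|F x|.-1%N.
  move=> /(lipschitz_above_reach F0 lF oF).
  by have := F0 x; move=> /=; lia.
move=> unr.
(* [f x + 1] is the lowest positive height in column [x] that is not reached. *)
have /choice[f fP] : forall x, exists h : nat, ~ reach w (x, h.+1%:Z) /\
    forall k : nat, (k <= h)%N -> reach w (x, k%:Z).
  move=> x; have ex : exists h : nat, `[< ~ reach w (x, h.+1%:Z) >].
    by have [h hx] := unr x; exists h; apply/asboolP.
  exists (ex_minn ex); case: ex_minnP => h /asboolP nh hm.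
  split => // -[_|k kh].
    exact: reach_base.
  apply: contrapT => nk; have := hm k (introT (asboolP _) nk); lia.
have lip (x : 'rV[int]_n) ib : (f (x + unit_vec ib)%R <= (f x).+1)%N.
  rewrite leqNgt; apply/negP => lt.
  have [nx _] := fP x; have [_ ry] := fP (x + unit_vec ib).
  apply: nx; apply: (@reach_diag _ _ ib) => /=.
  have := ry (f x).+2 lt; congr (reach _ (_, _)); lia.
exists (fun x => (f x).+1%:Z); split.
- by [].
- move=> x y xy.
  have [ib e1] := l1norm_eq1 xy.
  have yx : l1norm (y - x) = 1.
    by rewrite -xy /l1norm; apply: eq_bigr => i _; rewrite !mxE distrC.
  have [ib' e2] := l1norm_eq1 yx.
  have := lip y ib; have := lip x ib'; rewrite -e1 -e2 !subrKC; lia.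
- move=> x; apply: contrapT => /negP cl; have [nx rx] := fP x.
  apply: nx; apply: reach_down => //=.
  have := rx (f x) (leqnn _); congr (reach _ (_, _)); lia.
Qed.

(** * Measurability *)

Local Open Scope classical_set_scope.

Lemma measurable_all_closed (L : seq pos) :
  measurable [set w : config n.+1 | all_closed w L].
Proof.
elim: L => [|z L IHL].
  rewrite [X in measurable X](_ : _ = setT) //.
  by apply/seteqP; split.
have mz : measurable [set w : config n.+1 | w (site_at z)].
  by apply: sub_sigma_algebra; exists (site_at z).
rewrite [X in measurable X](_ : _ = ~` [set w : config n.+1 | w (site_at z)]
   `&` [set w : config n.+1 | all_closed w L]).
  by apply: measurableI => //; exact: measurableC.
apply/seteqP; split => w /=; first by case/andP => /negP.
by case=> /negP wz wL; apply/andP.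
Qed.

Lemma measurable_reach (z : pos) :
  measurable [set w : config n.+1 | reach w z].
Proof.
pose F (s : seq letter) := if (walk_end z s).2 == 0
  then [set w : config n.+1 | all_closed w (drops z s)] else set0.
rewrite [X in measurable X](_ : _ = \bigcup_s F s).
  apply: countable_bigcupT_measurable => [|s]; first exact: countableP.
  by rewrite /F; case: ifP => _ //; exact: measurable_all_closed.
apply/seteqP; split => w.
  by move=> [s [/eqP e c]]; exists s => //; rewrite /F e.
by move=> [s _]; rewrite /F; case: ifP => // /eqP e c; exists s.
Qed.

(** * The first moment bound *)

Fixpoint walks (N : nat) : seq (seq letter) :=
  if N is M.+1 then [seq a :: s | a <- enum {: letter}, s <- walks M]
  else [:: [::]].

Lemma walk_in_walks (s : seq letter) : s \in walks (size s).
Proof.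
by elim: s => [|a s IHs] //=; apply/allpairs_f => //; rewrite mem_enum.
Qed.

Variable R : realType.

(** Step weights that make the first moment a power: tilting by [theta] turns
    the constraint on the total loss of height into a prefactor, so that the
    steps of a walk may be summed over independently. *)
Definition weight (q theta : R) (a : letter) : R :=
  if a is Some _ then theta else q / theta.

Lemma sum_prod_walks (f : letter -> R) (N : nat) :
  \sum_(s <- walks N) \prod_(a <- s) f a = (\sum_a f a) ^+ N.
Proof.
elim: N => [|N IHN]; first by rewrite big_seq1 big_nil expr0.
rewrite /= big_allpairs_dep exprS -IHN big_distrl /= big_enum /=.
apply: eq_bigr => a _; rewrite big_distrr /=; apply: eq_bigr => s _.
by rewrite big_cons.
Qed.

Lemma sum_weight (q theta : R) :
  \sum_a weight q theta a = q / theta + (2 * n)%:R * theta.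
Proof.
rewrite (bigD1 None) //=; congr (_ + _).
rewrite (eq_bigr (fun=> theta)) => [|[]//].
rewrite sumr_const cardC1 card_option card_prod card_ord card_bool /=.
by rewrite mulnC mulr_natl.
Qed.

(** Each downward step contributes [q = theta * (q / theta)] and each diagonal
    step [1 = theta^-1 * theta]; the powers of [theta] in front add up to the
    total loss of height. *)
Lemma weight_drops (q theta : R) (z : pos) (s : seq letter) : theta != 0 ->
  q ^+ size (drops z s) =
  theta ^ (z.2 - (walk_end z s).2) * \prod_(a <- s) weight q theta a.
Proof.
move=> t0; elim: s z => [|a s IHs] z.
  by rewrite /= subrr expr0z big_nil expr0 mul1r.
rewrite big_cons; case: a => [ib|]; rewrite /= ?exprS IHs /=.
  set e := (walk_end _ s).2.
  rewrite (_ : z.2 + 1 - e = z.2 - e + 1); last by ring.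
  by rewrite expfzDr // expr1z mulrA.
set e := (walk_end _ s).2.
rewrite (_ : z.2 - e = z.2 - 1 - e + 1); last by ring.
by rewrite [in RHS]expfzDr // expr1z; field.
Qed.

Section Probability.
Variables (p : R) (P : probability (config n.+1) R).
Hypothesis hP : is_site_percolation p P.

Lemma prob_all_closed (L : seq pos) : uniq L ->
  P [set w : config n.+1 | all_closed w L] = ((1 - p) ^+ size L)%:E.
Proof.
move=> uL.
have [S inS sS] : exists2 S : {fset site n.+1}, S =i map site_at L
    & size S = size L.
  exists (seq_fset tt (map site_at L)); first exact: seq_fsetE.
  rewrite size_seq_fset undup_id ?size_map // map_inj_uniq //.
  exact: site_over_inj.
have := hP S (fun=> false).
rewrite big_const_seq count_predT iter_mulr_1 sS => <-.
congr (P _); apply/seteqP; split => w /=.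
  by move=> /allP c s; rewrite inS => /mapP[z /c /negbTE cz ->].
move=> c; apply/allP => z zL; rewrite c // inS; exact: map_f.
Qed.

Lemma prob_union_le (I : choiceType) (r : seq I) (F : I -> set (config n.+1))
    (b : I -> R) :
  (forall i, measurable (F i)) -> (forall i, P (F i) <= (b i)%:E)%E ->
  (P (\bigcup_(i in [set` r]) F i) <= (\sum_(i <- r) b i)%:E)%E.
Proof.
move=> mF Fb; rewrite bigcup_seq; elim: r => [|i r IHr].
  by rewrite !big_nil measure0.
rewrite !big_cons EFinD.
apply: le_trans (leeD (Fb i) IHr).
by apply: measureU2 => //; exact: bigsetU_measurable.
Qed.

(** A union bound over all walks with distinct downward sites, grouped by their
    length: those of length [N] contribute at most [theta ^+ h * r ^+ N]. *)
Lemma prob_reach_le (theta r : R) (x : 'rV[int]_n) (h : nat) :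
  0 <= 1 - p -> 0 < theta -> (1 - p) / theta + (2 * n)%:R * theta = r ->
  0 < r < 1 ->
  (P [set w : config n.+1 | reach w (x, h%:Z)] <= (theta ^+ h / (1 - r))%:E)%E.
Proof.
move=> q0 t0 er /andP[r0 r1].
pose good s := ((walk_end (x, h%:Z) s).2 == 0) && uniq (drops (x, h%:Z) s).
pose F s := if good s
  then [set w : config n.+1 | all_closed w (drops (x, h%:Z) s)] else set0.
have mF s : measurable (F s).
  by rewrite /F; case: ifP => _ //; exact: measurable_all_closed.
pose W := weight (1 - p) theta.
have W0 a : 0 <= W a.
  by case: a => [ib|] /=; [exact: ltW | rewrite divr_ge0 // ltW].
have PF s : (P (F s) <= (theta ^+ h * \prod_(a <- s) W a)%:E)%E.
  rewrite /F; case: ifP => [/andP[/eqP e u]|_]; last first.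
    by rewrite measure0 lee_fin mulr_ge0 ?exprn_ge0 ?prodr_ge0 // ltW.
  rewrite prob_all_closed // (@weight_drops _ theta) ?gt_eqF //.
  by rewrite e subr0.
pose E N := \bigcup_(s in [set` walks N]) F s.
have mE N : measurable (E N).
  by rewrite /E bigcup_seq; exact: bigsetU_measurable.
have PE N : (P (E N) <= (theta ^+ h * r ^+ N)%:E)%E.
  rewrite -er -sum_weight -sum_prod_walks big_distrr /=.
  exact: prob_union_le.
have sub : [set w : config n.+1 | reach w (x, h%:Z)] `<=` \bigcup_N E N.
  move=> w /reach_simple[s [e u c]]; exists (size s) => //.
  exists s; first exact: walk_in_walks.
  by rewrite /F /good e u.
apply: le_trans (measure_sigma_subadditive P _ _ sub) _ => //.
  exact: measurable_reach.
apply: lime_le; first exact: is_cvg_nneseries.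
apply: nearW => N.
apply: le_trans (_ : \sum_(0 <= k < N) (theta ^+ h * r ^+ k)%:E <= _)%E.
  by apply: lee_sum => k _; exact: PE.
rewrite sumEFin lee_fin.
by apply: (@geometric_le_lim _ N) => //; rewrite ?exprn_ge0 ?gtr0_norm // ltW.
Qed.

(** The event that a column is reached at all heights has probability at most
    that of being reached at any single height, and this tends to 0. *)
Lemma prob_LIP1 : (0 < n)%N -> 1 - 1 / (8 * n%:R) < p <= 1 ->
  P (@LIP n.+1) = 1%:E.
Proof.
move=> n0 /andP[pl p1].
have n0' : 0 < n%:R :> R by rewrite ltr0n.
(* This choice gives the diagonal steps a total weight of 1/2, and makes the
   total weight of all steps less than 1 as soon as [1 - p < 1 / (8 n)]. *)
pose theta : R := 1 / (4 * n%:R).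
have t0 : 0 < theta by rewrite divr_gt0 // mulr_gt0.
have t1 : theta < 1.
  rewrite ltr_pdivrMr ?mulr_gt0 // mul1r.
  have : 1 <= n%:R :> R by rewrite ler1n.
  lra.
pose r := (1 - p) / theta + (2 * n)%:R * theta.
have rE : r = 4 * n%:R * (1 - p) + 1 / 2.
  by rewrite /r /theta natrM; field; rewrite gt_eqF.
have r01 : 0 < r < 1.
  have : 0 <= n%:R * (1 - p) by rewrite mulr_ge0 // subr_ge0.
  have : n%:R * (1 - p) < 1 / 8.
    rewrite -ltr_pdivlMl //; move: pl.
    rewrite (_ : 1 / (8 * n%:R) = n%:R^-1 * (1 / 8)); first by lra.
    by field; rewrite gt_eqF.
  rewrite rE; set y := n%:R * (1 - p).
  rewrite -mulrA -/y; lra.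
have q0 : 0 <= 1 - p by rewrite subr_ge0.
pose B (x : 'rV[int]_n) :=
  \bigcap_h [set w : config n.+1 | reach w (x, h.+1%:Z)].
have mB x : measurable (B x).
  by apply: bigcapT_measurable => h; exact: measurable_reach.
have PB x : P (B x) = 0%E.
  apply/eqP; rewrite eq_le measure_ge0 andbT.
  have fB : P (B x) \is a fin_num by exact: fin_num_measure.
  rewrite -(fineK fB) lee_fin.
  have cv : geometric (1 - r)^-1 theta @ \oo --> (0 : R).
    by apply: cvg_geometric; rewrite gtr0_norm.
  have /cvgP cv' := cv.
  rewrite -(cvg_lim _ cv) //; apply: limr_ge => //; apply: nearW => h.
  rewrite -lee_fin fineK //=.
  apply: (@le_trans _ _ (P [set w : config n.+1 | reach w (x, h.+1%:Z)])).
    apply: le_measure; rewrite ?inE //; first exact: measurable_reach.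
    by move=> w; exact.
  apply: le_trans (prob_reach_le _ _ q0 t0 erefl r01) _.
  rewrite lee_fin mulrC ler_wpM2l //; last first.
    by rewrite exprS ler_piMl ?exprn_ge0 // ltW.
  by rewrite invr_ge0 subr_ge0 ltW //; case/andP: r01.
have LE : @LIP n.+1 = ~` (\bigcup_x B x).
  apply/seteqP; split => w.
    by move=> /LIP_reach unr [x _ Bx]; have [h] := unr x; apply; exact: Bx.
  move=> nB; apply/LIP_reach => x; apply: contrapT => nx; apply: nB.
  by exists x => // h _; apply: contrapT => nr; apply: nx; exists h.
have mU : measurable (\bigcup_x B x).
  by apply: countable_bigcupT_measurable => //; exact: countableP.
rewrite LE probability_setC //.
suff -> : P (\bigcup_x B x) = 0%E by rewrite sube0.
apply: measure_negligible => //.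
(* Countable additivity is indexed by naturals, so the columns are
   enumerated. *)
pose G k := if choice.unpickle k is Some x then B x else set0.
have <- : \bigcup_k G k = \bigcup_x B x.
  apply/seteqP; split => w.
    by move=> [k _]; rewrite /G; case: choice.unpickle => // x Bx; exists x.
  by move=> [x _ Bx]; exists (choice.pickle x) => //; rewrite /G choice.pickleK.
apply: negligible_bigcup => k; rewrite /G.
case: choice.unpickle => [x|]; last exact: negligible_set0.
by apply/negligibleP; [exact: mB|exact: PB].
Qed.

End Probability.

End Walks.

(** * The critical probability *)

Theorem theorem1 (R : realType) (d : nat) (hd : (2 <= d)%N)
    (P : R -> probability (config d) R)
    (hP : forall p : R, 0 <= p <= 1 -> is_site_percolation p (P p))
    (pL : R) (hpL : is_critical_probability P pL) :
  pL <= 1 - 1 / (8 * (d%:R - 1)).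
Proof.
case: d hd P hP hpL => // n hn P hP [/andP[pL0 pL1] sub _].
have n0 : 0 < n%:R :> R by rewrite ltr0n.
rewrite -[n.+1%:R]natr1 addrK leNgt; apply/negP => lt.
set c := 1 - 1 / (8 * n%:R) in lt *.
have c0 : 0 <= c.
  rewrite subr_ge0 ler_pdivrMr ?mulr_gt0 // mul1r.
  have : 1 <= n%:R :> R by rewrite ler1n.
  lra.
(* A parameter strictly between the bound and [pL], where [LIP] would have
   probability both 0 and 1. *)
pose p := (c + pL) / 2.
have [p01 pc pp p1] : [/\ 0 <= p <= 1, c < p, p < pL & p <= 1].
  by rewrite /p; split; [apply/andP; split| | |]; lra.
have := sub p p01 pp.
rewrite (prob_LIP1 (hP p p01)) //; last by rewrite pc.
by move/eqP; rewrite eqe oner_eq0.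
Qed.
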